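(* Let $U$ be a ground set with $|U| = n$, let $\mathcal{F} \subseteq 2^U$ be any family of feasible sets, and let $w^*: U \to \mathbb{R}$ be an unknown weight function, accessible only through a comparison oracle on $\mathcal{F}$. Then one can find $\arg\min_{S \in \mathcal{F}} \sum_{e \in S} w^*_e$ using $O(n \log^2 n \cdot \log |\mathcal{F}|) = \widetilde{O}(n^2)$ comparison queries.
   Context: For $S \subseteq U$ write $w^*(S) := \sum_{e \in S} w^*_e$. A comparison query takes two feasible sets $S, T \in \mathcal{F}$ and reveals whether $w^*(S) < w^*(T)$, $w^*(S) = w^*(T)$, or $w^*(S) > w^*(T)$. Only the number of queries is counted; computation time is not bounded. *)

(* Defs.v *)
From HB Require Import structures.
From mathcomp Require Import all_boot all_order all_algebra.
From mathcomp Require Import reals exp.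

Set Implicit Arguments.
Unset Strict Implicit.
Unset Printing Implicit Defensive.

Import Order.TTheory GRing.Theory Num.Theory.
Local Open Scope ring_scope.

Definition weight (R : realType) (U : finType) (w : U -> R) (S : {set U}) : R :=
  \sum_(e in S) w e.

Definition argmin (R : realType) (U : finType) (F : {set {set U}})
    (w : U -> R) : {set {set U}} :=
  [set S in F | [forall T in F, weight w S <= weight w T]].

Definition comparison_oracle (R : realType) (U : finType) (w : U -> R)
    (S T : {set U}) : comparison :=
  if weight w S < weight w T then Lt
  else if weight w S == weight w T then Eq else Gt.

(* Deterministic adaptive algorithms, as ternary decision trees. Computation
   is free in this model: only the [Query] nodes met along a run are counted. *)
Inductive algorithm (U : finType) : Type :=
  | Output of {set U}
  | Query (S T : {set U}) of (comparison -> algorithm U).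

Fixpoint queries_within (U : finType) (F : {set {set U}})
    (a : algorithm U) : Prop :=
  match a with
  | Output _ => True
  | Query A B next =>
      [/\ A \in F, B \in F & forall c, queries_within F (next c)]
  end.

(* The weights are reachable only through the answers of [oracle]. *)
Fixpoint output (U : finType) (oracle : {set U} -> {set U} -> comparison)
    (a : algorithm U) : {set U} :=
  match a with
  | Output A => A
  | Query A B next => output oracle (next (oracle A B))
  end.

Fixpoint query_count (U : finType) (oracle : {set U} -> {set U} -> comparison)
    (a : algorithm U) : nat :=
  match a with
  | Output _ => 0%N
  | Query A B next => (query_count oracle (next (oracle A B))).+1
  end.

(* n log^2 n log |F|, with m = |F|; the base of the logarithm only affects the
   implied constant. *)
Definition query_bound (R : realType) (n m : nat) : R :=
  n%:R * ln n%:R ^+ 2 * ln m%:R.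

(* Main.v *)
Require Import Defs.
From HB Require Import structures.
From mathcomp Require Import all_boot all_order all_algebra.
From mathcomp Require Import reals exp.
From mathcomp Require Import boolp zify ring lra.

Set Implicit Arguments.
Unset Strict Implicit.
Unset Printing Implicit Defensive.

Import Order.TTheory GRing.Theory Num.Theory.
Local Open Scope ring_scope.

(** A sorted list [a 0 <= ... <= a d] with [2 ^ d > (d + 1) ^ n] contains an
    [a k.+1] whose inequality [a 0 <= a k.+1] already follows from the order of
    [a 0, ..., a k] (pigeonhole on sums of choices). So in any list at most
    [d = O(n log n)] entries are "new", i.e. not known to dominate one of the
    others. Symmetrization then shows that, for a fixed weight, a random word of
    length [m = 64 d] over the surviving family [X] fails to eliminate a
    sixteenth of [X] only with probability at most [2 * 2 ^ (- m)].

    The weights realize at most [(|F| ^ 2 + 1) ^ n] different orders on [F], and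
    averaging over the orders still possible yields one word that fails for at
    most a [2 * 2 ^ (- m)] fraction of them. Sorting this word costs
    [O(m log m)] queries and either shrinks [X] by a constant factor or divides
    the number of possible orders by [2 ^ (m - 1)]; each of these can happen
    [O(log |F|)] times. *)

(** * Sign patterns of linear forms *)

Lemma leq_exp2r_weak a b k : (a <= b)%N -> (a ^ k <= b ^ k)%N.
Proof. by case: k => // k le_ab; rewrite leq_exp2r. Qed.

Definition sign_pattern (R : realFieldType) D (vs : seq 'cV[R]_D) (w : 'rV[R]_D) :=
  [seq 0 <= (w *m v) 0 0 | v <- vs].

(** The combination [a *: w2 - b *: w1] has coefficients [a >= 0] and [- b > 0] and annihilates [v].
    A form with the same sign bit at [w1] and [w2] keeps that bit; for a negative form this uses
    that [- b] is strictly positive. *)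
Lemma sign_pattern_hyperplane (R : realFieldType) D (vs : seq 'cV[R]_D)
    (v : 'cV[R]_D) (w1 w2 : 'rV[R]_D) :
    sign_pattern vs w1 = sign_pattern vs w2 ->
    0 <= (w1 *m v) 0 0 -> (w2 *m v) 0 0 < 0 ->
  exists2 w, w *m v = 0 & sign_pattern vs w = sign_pattern vs w2.
Proof.
set a := (w1 *m v) 0 0; set b := (w2 *m v) 0 0 => eq12 a_ge0 b_lt0.
have comb u : ((a *: w2 - b *: w1) *m u) 0 0 = a * (w2 *m u) 0 0 - b * (w1 *m u) 0 0.
  by rewrite mulmxBl -!scalemxAl !mxE.
exists (a *: w2 - b *: w1).
  by apply/matrixP=> i j; rewrite !ord1 comb [RHS]mxE -/a -/b; ring.
elim: vs eq12 => //= u vs IH [equ /IH ->]; congr (_ :: _).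
rewrite comb; move: equ; move: ((w1 *m u) 0 0) ((w2 *m u) 0 0) => x1 x2.
case: (lerP 0 x1) => x1_0 /esym x2_0; rewrite x2_0; first by nra.
by move/negbT: x2_0; rewrite -ltNge => x2_0; apply/negbTE; rewrite -ltNge; nra.
Qed.

(** Deletion and restriction: a pattern of [vs] extends to [v :: vs] in one way, unless both bits of
    [v] occur with it, and then it is realized on the hyperplane where [v] vanishes. The count
    closes with [(k+1)^D + (k+1)^(D-1) <= (k+2)^D]. *)
Lemma card_sign_patterns (R : realFieldType) D (vs : seq 'cV[R]_D) :
  exists2 L : seq (seq bool), (size L <= (size vs).+1 ^ D)%N &
    forall w, sign_pattern vs w \in L.
Proof.
move: {2}(size vs) (erefl (size vs)) => k; elim: k D vs => [|k IH] D [|v vs] //=.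
  by exists [:: [::]] => [|w]; rewrite ?exp1n // inE.
case=> size_vs; have [L0 size_L0 L0P] := IH D vs size_vs.
case: (eqVneq v 0) => [->|v_neq0].
  exists [seq true :: p | p <- L0].
    by rewrite size_map (leq_trans size_L0) // leq_exp2r_weak // size_vs.
  by move=> w; rewrite mulmx0 mxE lexx map_f.
pose K := row_base (kermx v).
have rankK : (\rank (kermx v)).+1 = D.
  have rank_v : \rank v = 1%N.
    by apply/eqP; rewrite eqn_leq rank_leq_col lt0n mxrank_eq0.
  by rewrite mxrank_ker rank_v subn1 prednK // -rank_v rank_leq_row.
have [L1] := IH _ [seq K *m u | u <- vs] (etrans (size_map _ _) size_vs).
rewrite size_map size_vs => size_L1 L1P.
(* [L0] supplies each pattern with one bit, [true] whenever that is realizable; patterns that also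
   occur with [false] are supplied by [L1]. *)
pose bit p := `[< exists2 w, sign_pattern vs w = p & 0 <= (w *m v) 0 0 >].
exists ([seq bit p :: p | p <- L0] ++ [seq false :: p | p <- L1]).
  rewrite size_cat !size_map (leq_trans (leq_add size_L0 size_L1)) // size_vs.
  move: rankK; move: (\rank _) => r <-.
  rewrite [in leqRHS]expnS mulSn addnC leq_add //.
    exact: leq_exp2r_weak.
  by rewrite expnS leq_mul // leq_exp2r_weak.
move=> w; set p := sign_pattern vs w; rewrite mem_cat.
have [/asboolP bitp|/asboolPn bitp] := boolP (bit p); last first.
  have w_lt0 : (0 <= (w *m v) 0 0) = false by apply/negP=> w_ge0; apply: bitp; exists w.
  rewrite w_lt0; apply/orP; left; apply/mapP; exists p; first exact: L0P.
  by congr (_ :: _); apply/esym/asboolPn.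
have [w_ge0|w_lt0] := lerP 0.
  apply/orP; left; apply/mapP; exists p; first exact: L0P.
  by congr (_ :: _); apply/esym/asboolP.
case: bitp => w1 eq1 w1_ge0.
have [w' w'v eq'] := sign_pattern_hyperplane eq1 w1_ge0 w_lt0.
apply/orP; right; apply: map_f; rewrite -[p]eq'.
have /submxP[x def_w'] : (w' <= K)%MS by rewrite eq_row_base sub_kermx w'v.
suff -> : sign_pattern vs w' = sign_pattern [seq K *m u | u <- vs] x by apply: L1P.
rewrite /sign_pattern -map_comp; apply: eq_map => u /=; by rewrite def_w' -(mulmxA x K u).
Qed.

(** * Random words *)

Section Sampling.
Local Open Scope nat_scope.

Fixpoint words (T : Type) (X : seq T) m : seq (seq T) :=
  if m is m'.+1 then [seq a :: s | a <- X, s <- words X m'] else [:: [::]].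

Definition delete (T : Type) q (s : seq T) := take q s ++ drop q.+1 s.

Lemma leq_bin_exp n k : 'C(n, k) <= 2 ^ n.
Proof.
elim: n k => [|n IH] [|k] //; first by rewrite bin0 expn_gt0.
by rewrite binS expnS mul2n -addnn leq_add.
Qed.

Variables (T : eqType) (x0 : T) (X : seq T) (new : seq T -> T -> bool) (d : nat).
Hypothesis new_anti : forall (s1 s2 : seq T) x, {subset s1 <= s2} -> new s2 x -> new s1 x.
Hypothesis new_dim : forall s,
  \sum_(q < size s) new (delete q s) (nth x0 s q) <= d.

Lemma big_words_S m (f : seq T -> nat) :
  \sum_(s <- words X m.+1) f s = \sum_(a <- X) \sum_(s <- words X m) f (a :: s).
Proof. by rewrite /= big_allpairs_dep. Qed.

Lemma size_words m : size (words X m) = size X ^ m.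
Proof. by elim: m => //= m IH; rewrite size_allpairs IH expnS. Qed.

Lemma mem_words m s : s \in words X m -> size s = m /\ {subset s <= X}.
Proof.
elim: m s => [|m IH] s /=; first by rewrite inE => /eqP ->.
case/allpairsP=> -[a t] /= [aX /IH[size_t tX] ->] /=; rewrite size_t; split=> // x.
by rewrite inE => /orP[/eqP ->|/tX].
Qed.

(** A uniform word of length [m.+1] is a uniform letter at position [q] and an independent uniform
    word of length [m]. *)
Lemma big_words_delete m q (f : T -> seq T -> nat) : q <= m ->
  \sum_(s <- words X m.+1) f (nth x0 s q) (delete q s)
    = \sum_(a <- X) \sum_(s <- words X m) f a s.
Proof.
elim: q m f => [|q IH] m f.
  by move=> _; rewrite big_words_S; do 2![apply: eq_bigr => ? _]; rewrite /delete /= drop0.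
case: m => // m le_qm; rewrite big_words_S.
under eq_bigr => a _ do rewrite (IH m (fun b s => f b (a :: s)) le_qm).
rewrite exchange_big /=; apply: eq_bigr => a _; by rewrite big_words_S.
Qed.

(** The word is thought of as growing from its last letter: each letter is tested against those to
    its right. *)
Fixpoint news s := if s is a :: s' then new s' a + news s' else 0.
Fixpoint olds s := if s is a :: s' then ~~ new s' a + olds s' else 0.

Lemma news_olds s : news s + olds s = size s.
Proof. by elim: s => //= a s <-; case: (new s a) => /=; lia. Qed.

(* The sum over all orders in which the letters of [s] can be removed one by
   one, each removed letter that is new to those left weighing [c]. *)
Fixpoint orders c m s :=
  if m is m'.+1 then
    \sum_(q < m'.+1) c ^ new (delete q s) (nth x0 s q) * orders c m' (delete q s)
  else 1.

Lemma size_delete m q (s : seq T) : size s = m.+1 -> q <= m -> size (delete q s) = m.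
Proof. by move=> size_s le_qm; rewrite size_cat size_takel ?size_drop ?size_s; lia. Qed.

Lemma delete_mem q (s : seq T) : q < size s -> nth x0 s q :: delete q s =i s.
Proof.
move=> lt_qs; apply: perm_mem; rewrite -[in X in perm_eq _ X](cat_take_drop q s).
by rewrite (drop_nth x0 lt_qs) /delete perm_sym perm_catC /= perm_cons perm_catC.
Qed.

Lemma new_eq_mem (s1 s2 : seq T) x : s1 =i s2 -> new s1 x = new s2 x.
Proof. by move=> eqs; apply/idP/idP; apply: new_anti => y; rewrite eqs. Qed.

(* Exchangeability: the position removed first is as good as the head. *)
Lemma sum_orders c m (f : seq T -> nat) : (forall s1 s2 : seq T, s1 =i s2 -> f s1 = f s2) ->
  \sum_(s <- words X m) f s * orders c m s
    = m`! * \sum_(s <- words X m) f s * c ^ news s.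
Proof.
elim: m f => [|m IH] f f_mem; first by rewrite !big_seq1 mul1n.
under eq_big_seq => s /mem_words[size_s _].
  rewrite /= big_distrr /=.
  under eq_bigr => q _.
    rewrite -(f_mem _ _ (delete_mem (_ : q < size s))) ?size_s // mulnA.
    over.
  over.
rewrite exchange_big /=.
under eq_bigr => q _.
  rewrite (big_words_delete (fun a s => f (a :: s) * c ^ new s a * orders c m s));
    last by rewrite -ltnS.
  under eq_bigr => a _.
    rewrite (IH (fun s => f (a :: s) * c ^ new s a)); last first.
      move=> s1 s2 eqs; rewrite (new_eq_mem _ eqs) (f_mem (a :: s1) (a :: s2)) // => y.
      by rewrite !inE eqs.
    over.
  rewrite -big_distrr /=.
  over.
rewrite sum_nat_const card_ord mulnA -factS; congr (_ * _).
rewrite big_words_S; do 2!apply: eq_bigr => ? _; by rewrite /= expnD mulnA.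
Qed.

(** At most [d] positions are new, so the weights of the first removal sum to at most [m + c * d].
    Iterating gives the product of the [j + c * d] for [1 <= j <= m], a quotient of factorials. *)
Lemma orders_bound c m s : size s = m -> orders c m s * (c * d)`! <= (m + c * d)`!.
Proof.
elim: m s => [|m IH] s size_s; first by rewrite mul1n.
rewrite /= big_distrl /= addSn factS.
apply: (@leq_trans (\sum_(q < m.+1) (1 + c * new (delete q s) (nth x0 s q)) * (m + c * d)`!)).
  apply: leq_sum => q _; rewrite -mulnA leq_mul //; last first.
    by rewrite IH // (@size_delete m) // -ltnS.
  by case: new; rewrite ?expn1 ?expn0; lia.
rewrite -big_distrl leq_mul2r /= big_split /= sum1_card card_ord -big_distrr /= -addSn.
by rewrite leq_add2l leq_mul2l; move: (new_dim s); rewrite size_s => ->; rewrite !orbT.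
Qed.

(** By exchangeability the average of [c ^ news s] is that of [orders c m s] divided by [m!]. With
    [c * d = m] this is at most the central binomial coefficient of [2 m], hence at most [4 ^ m]. *)
Lemma sum_news c m : c * d = m ->
  \sum_(s <- words X m) c ^ news s <= (4 * size X) ^ m.
Proof.
move=> def_m; rewrite -(leq_pmul2l (fact_gt0 m)).
have := @sum_orders c m (fun=> 1) (fun _ _ _ => erefl).
under [in X in _ = X -> _]eq_bigr => s _ do rewrite mul1n.
move=> <-; rewrite -(leq_pmul2r (fact_gt0 m)) big_distrl /=.
apply: (@leq_trans (\sum_(s <- words X m) (m + m)`!)).
  rewrite big_seq [leqRHS]big_seq; apply: leq_sum => s /mem_words[size_s _].
  by rewrite mul1n -{2 4}def_m orders_bound.
rewrite big_const_seq count_predT iter_addn_0 size_words.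
rewrite -(@bin_fact (m + m) m) ?leq_addr // addnK mulnC expnMn.
rewrite -[4]/(2 ^ 2) -expnM mul2n -addnn.
have := leq_bin_exp (m+m) m; nia.
Qed.

Definition uninformative s := 16 * count (predC (new s)) X <= size X.

(** Every suffix of an uninformative word is uninformative, so at each stage at most a sixteenth of
    the next letters are old. Weighing those by 16 multiplies the sum by at most
    [(1 + 15/16) * size X]. *)
Lemma sum_olds m :
  \sum_(s <- words X m | uninformative s) 16 ^ olds s <= (2 * size X) ^ m.
Proof.
elim: m => [|m IH]; first by rewrite /= big_mkcond big_seq1; case: ifP.
rewrite big_mkcond big_words_S exchange_big /=.
apply: (@leq_trans (\sum_(s <- words X m | uninformative s) 16 ^ olds s * (2 * size X))); last first.
  by rewrite -big_distrl /= expnSr leq_mul2r IH orbT.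
rewrite [leqRHS]big_mkcond leq_sum // => s _.
have [bad_s|good_s] := boolP (uninformative s); last first.
  rewrite big1 // => a _; case: ifP => // bad_as.
  case/negP: good_s; apply: leq_trans bad_as; rewrite leq_mul2l /=.
  apply: sub_count => x /=; apply: contra; by apply: new_anti => y ys; rewrite inE ys orbT.
apply: (@leq_trans (\sum_(a <- X) 16 ^ olds s * (1 + 15 * ~~ new s a))).
  apply: leq_sum => a _; case: ifP => // _; rewrite expnD.
  by case: new; rewrite /= ?expn0 ?expn1; nia.
rewrite -big_distrr leq_mul2l /= big_split /= -big_distrr /= sum1_size.
rewrite [X in _ + 15 * X <= _](_ : _ = count (predC (new s)) X).
  by move: bad_s; rewrite /uninformative; lia.
rewrite -sum1_count [RHS]big_mkcond; apply: eq_bigr => a _ /=; by case: new.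
Qed.

(* At least half of the [2 r] letters of an uninformative word are old, which
   [sum_olds] makes rare, or at least half are new, which [sum_news] makes rare. *)
Lemma few_uninformative r : 64 * d = r.*2 ->
  count uninformative (words X r.*2) * 2 ^ r.*2 <= 2 * size X ^ r.*2.
Proof.
move=> def_r; set m := r.*2.
have pow2 k : k ^ m = (k ^ 2) ^ r by rewrite /m -muln2 mulnC expnM.
have := sum_news def_r; have := sum_olds m.
rewrite -/m !expnMn !(pow2 2) !(pow2 4) -[2 ^ 2]/4 -[4 ^ 2]/16.
set A := \sum_(s <- _ | _) _; set B := \sum_(s <- _) _; set N := size X ^ m => leA leB.
(* Either [olds s >= r], and [4 ^ r * 16 ^ olds s] reaches [64 ^ r], or [news s >= r], and
   [64 ^ news s] does. Both sums on the right are at most [16 ^ r * N]. *)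
have : count uninformative (words X m) * 64 ^ r <= 4 ^ r * A + B.
  rewrite -sum1_count big_distrl /= /A /B big_distrr /=.
  apply: (@leq_trans (\sum_(s <- words X m | uninformative s) (4 ^ r * 16 ^ olds s + 64 ^ news s))).
    rewrite big_seq_cond [leqRHS]big_seq_cond leq_sum // => s /andP[/mem_words[size_s _] _].
    rewrite mul1n; have [le_r|lt_r] := leqP r (olds s).
      rewrite -[64]/(4 * 16) expnMn (leq_trans _ (leq_addr _ _)) //.
      by rewrite leq_mul2l leq_exp2l // le_r orbT.
    rewrite (leq_trans _ (leq_addl _ _)) // leq_exp2l //.
    by have := news_olds s; rewrite size_s /m; lia.
  rewrite big_split /= leq_add2l [leqLHS]big_mkcond /=; apply: leq_sum => s _; by case: ifP.
have -> : 64 ^ r = 4 ^ r * 16 ^ r by rewrite -expnMn.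
have -> : 16 ^ r = 4 ^ r * 4 ^ r by rewrite -expnMn.
move: leA leB; rewrite -[16]/(4*4) expnMn; have := expn_gt0 4 r => /=.
set q := 4 ^ r => q0 leA leB H.
suff : (count uninformative (words X m) * q) * (q * q) <= (2 * N) * (q * q).
  by rewrite leq_pmul2r // muln_gt0 q0.
nia.
Qed.
End Sampling.

(** * Inference from comparisons *)

Section Weights.
Variables (R : realType) (U : finType).
Implicit Types (w : U -> R) (S T : {set U}) (F : {set {set U}}).

(* Ties are broken by [enum_rank], so that a sorted list determines the whole
   relation [before w] on its members. *)
Definition before w S T :=
  (weight w S < weight w T)
  || (weight w S == weight w T) && (enum_rank S <= enum_rank T)%N.

Lemma before_weight w S T : before w S T -> weight w S <= weight w T.
Proof. by case/orP=> [/ltW //|/andP[/eqP -> _]]. Qed.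

Lemma before_total w : total (before w).
Proof. by move=> S T; rewrite /before; case: ltgtP => //= _; exact: leq_total. Qed.

Lemma before_trans w : transitive (before w).
Proof.
move=> T S V /orP[ltST|/andP[/eqP eqST leST]] /orP[ltTV|/andP[/eqP eqTV leTV]].
- by rewrite /before (lt_trans ltST).
- by rewrite /before -eqTV ltST.
- by rewrite /before eqST ltTV.
by rewrite /before eqST eqTV eqxx (leq_trans leST) // orbT.
Qed.

Lemma before_anti w : antisymmetric (before w).
Proof.
move=> S T /andP[]; rewrite /before; case: ltgtP => //= _ leST leTS.
by apply/enum_rank_inj/val_inj/eqP; rewrite eqn_leq leST.
Qed.

Lemma weightE w S : weight w S = \sum_e w e * (e \in S)%:R.
Proof.
rewrite /weight big_mkcond; apply: eq_bigr => e _.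
by case: (e \in S); rewrite ?mulr1 ?mulr0.
Qed.

Definition same_order F w w' := {in F &, forall S T,
  (weight w S <= weight w T) = (weight w' S <= weight w' T)}.

Lemma same_order_before F w w' : same_order F w w' ->
  {in F &, forall S T, before w S T = before w' S T}.
Proof.
by move=> ww' S T SF TF; rewrite /before !lt_neqAle !eq_le !ww'.
Qed.

(** Comparing two sets is a sign test on the difference of their indicator vectors, so an order on
    [F] is a sign pattern of [#|F| ^ 2] forms. One weight is chosen per pattern. *)
Lemma finite_weight_orders F : exists (K : nat) (rep : 'I_K -> U -> R),
  (K <= (#|F| * #|F|).+1 ^ #|U|)%N /\ forall w, exists i, same_order F w (rep i).
Proof.
pose form (p : {set U} * {set U}) : 'cV[R]_#|U| :=
  \col_i ((enum_val i \in p.2)%:R - (enum_val i \in p.1)%:R).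
pose pairs := [seq (A, B) | A <- enum F, B <- enum F].
pose vec w : 'rV[R]_#|U| := \row_i w (enum_val i).
have vec_form w p : (vec w *m form p) 0 0 = weight w p.2 - weight w p.1.
  rewrite !weightE -sumrB mxE (reindex _ (onW_bij _ (@enum_val_bij U))) /=.
  by apply: eq_bigr => i _; rewrite !mxE mulrBr.
have [L size_L LP] := card_sign_patterns [seq form p | p <- pairs].
pose pat w := sign_pattern [seq form p | p <- pairs] (vec w).
have patE w : pat w = [seq weight w p.1 <= weight w p.2 | p <- pairs].
  by rewrite /pat /sign_pattern -map_comp; apply: eq_map => p /=; rewrite vec_form subr_ge0.
(* A listed pattern that no weight realizes gets the zero weight, and its condition holds
   vacuously. *)
have /choice[rep repP] (i : 'I_(size L)) :
    exists w, forall w', pat w' = nth [::] L i -> pat w = nth [::] L i.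
  by have [[w patw]|nw] := pselect (exists w, pat w = nth [::] L i);
    [exists w | exists (fun=> 0) => w' pw'; case: nw; exists w'].
exists (size L), rep; split.
  by move: size_L; rewrite size_map size_allpairs -cardE.
move=> w; have pw : pat w \in L by exact: LP.
have lt_i : (index (pat w) L < size L)%N by rewrite index_mem.
exists (Ordinal lt_i) => S T SF TF.
have := repP (Ordinal lt_i) w; rewrite /= nth_index // => /(_ erefl).
set r := rep _; rewrite (patE w) (patE r) => /eq_in_map/(_ (S, T)) /= <- //.
by apply/allpairsP; exists (S, T); rewrite /= !mem_enum.
Qed.

(* Pigeonhole: two of the [2 ^ d] ways to choose one set in each pair
   [a j], [a j.+1] cover every element equally often, hence have equal total
   weight; at the last pair [k] where they differ, this bounds the step from
   [a k] to [a k.+1] from below by the steps before it. *)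
Lemma chain_inference (a : nat -> {set U}) d : (d.+1 ^ #|U| < 2 ^ d)%N ->
  exists2 k, (k < d)%N & forall w,
    (forall j, (j < k)%N -> weight w (a j) <= weight w (a j.+1)) ->
    weight w (a 0%N) <= weight w (a k.+1).
Proof.
move=> lt_card.
pose sel (e : {ffun 'I_d -> bool}) (j : 'I_d) := a (j + e j)%N.
pose cover (e : {ffun 'I_d -> bool}) (u : U) := (\sum_j (u \in sel e j))%N.
have cover_le e u : (cover e u < d.+1)%N.
  rewrite ltnS -[leqRHS]card_ord -sum1_card leq_sum // => j _; exact: leq_b1.
pose f e := [ffun u => Ordinal (cover_le e u)].
have [e1 [e2 ne12 eq12]] : exists e1, exists2 e2, e1 != e2 & f e1 = f e2.
  apply/injectivePn/negP => /injectiveP /leq_card.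
  by rewrite !card_ffun card_bool !card_ord leqNgt lt_card.
have tot w : \sum_j weight w (sel e1 j) = \sum_j weight w (sel e2 j).
  have totE e : \sum_j weight w (sel e j) = \sum_u w u * (cover e u)%:R.
    under eq_bigr => j _ do rewrite weightE.
    rewrite exchange_big; apply: eq_bigr => u _.
    by rewrite -mulr_sumr natr_sum.
  rewrite !totE; apply: eq_bigr => u _; congr (_ * _%:R).
  by have /ffunP/(_ u) := eq12; rewrite !ffunE => -[].
have [k0 k0P] : exists k0, e1 k0 != e2 k0.
  apply/existsP; rewrite -negb_forall; apply: contra ne12 => /forallP eq_e.
  by apply/eqP/ffunP => j; exact/eqP.
case: (@arg_maxnP _ k0 (fun k => e1 k != e2 k) (fun k => k : nat) k0P) => k ne_k max_k.
exists k => // w incr_w; clear eq12 k0 k0P f ne12.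
wlog e1k : e1 e2 tot ne_k max_k / e1 k.
  move=> IH; have [e1k|e1k] := boolP (e1 k); first exact: (IH e1 e2).
  apply: (IH e2 e1) => // [|j|]; first by rewrite eq_sym.
    by rewrite eq_sym; exact: max_k.
  by move: ne_k e1k; case: (e1 k); case: (e2 k).
have e2k : e2 k = false by move: ne_k; rewrite e1k; case: (e2 k).
have := tot w; rewrite (bigD1 k) //= [RHS](bigD1 k) //= /sel e1k e2k addn1 addn0.
set A := \sum_(j | _) _; set B := \sum_(j | _) _ => eqAB.
(* Beyond [k] the choices coincide and contribute nothing; below [k] each contributes at most the
   nonnegative step from [a j] to [a j.+1]. These steps telescope. *)
suff : A - B <= weight w (a k) - weight w (a 0%N) by lra.
rewrite -(telescope_sumr (fun j => weight w (a j))) // /A /B -sumrB big_mkord.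
rewrite (big_ord_widen d (fun j => weight w (a j.+1) - weight w (a j))) 1?ltnW //.
rewrite big_mkcond [leRHS]big_mkcond; apply: ler_sum => j _ /=.
case: ifP => [ne_jk|/negbFE/eqP ->]; last by rewrite ltnn.
case: ltnP => [lt_jk|le_kj].
  have := incr_w j lt_jk.
  by case: (e1 j); case: (e2 j); rewrite ?addn1 ?addn0; lra.
have -> : e1 j = e2 j.
  apply/eqP; apply: contraTT ne_jk => /max_k le_jk.
  by rewrite negbK -val_eqE eqn_leq le_kj andbT.
by rewrite subrr.
Qed.

(** * What the order of a sample implies *)

Section Cells.
Variables (K : nat) (rep : 'I_K -> U -> R).
Implicit Types (i j : 'I_K) (s : seq {set U}).

Definition agree i j s :=
  all (fun S => all (fun T => before (rep i) S T == before (rep j) S T) s) s.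

(* The order of [s] under [rep i] forces some member of [s] to weigh at most [T]. *)
Definition inferred i s T :=
  has (fun S => [forall j, agree i j s ==> (weight (rep j) S <= weight (rep j) T)]) s.

Definition new i s T := ~~ inferred i s T.

Lemma agreeP i j s :
  reflect {in s &, forall S T, before (rep i) S T = before (rep j) S T} (agree i j s).
Proof.
apply: (iffP allP) => [ag S T Ss Ts|ag S Ss].
  by have /allP/(_ T Ts)/eqP := ag S Ss.
by apply/allP=> T Ts; rewrite ag.
Qed.

Lemma inferredP i s T :
  reflect (exists2 S, S \in s & forall j, agree i j s -> weight (rep j) S <= weight (rep j) T)
    (inferred i s T).
Proof.
apply: (iffP hasP) => -[S Ss SP]; exists S => //.
  by move=> j; exact/implyP/(forallP SP).
by apply/forallP=> j; apply/implyP/SP.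
Qed.

Lemma new_anti i s1 s2 T : {subset s1 <= s2} -> new i s2 T -> new i s1 T.
Proof.
move=> sub12; apply: contra => /inferredP[S Ss1 SP]; apply/inferredP.
exists S => [|j /agreeP ag]; first exact: sub12.
by apply/SP/agreeP => ? ? /sub12 ? /sub12 ?; exact: ag.
Qed.

(** Agreement on [s] is an equivalence, so both sides quantify over the same indices. Hence any
    index compatible with the observed order can stand in for the unknown one. *)
Lemma new_agree i j s : agree i j s -> new i s =1 new j s.
Proof.
move=> /agreeP ij T; congr negb; apply/inferredP/inferredP => -[S Ss SP]; exists S => // k ag.
  by apply: SP; apply/agreeP => ? ? ? ?; rewrite ij // (agreeP _ _ _ ag).
by apply: SP; apply/agreeP => ? ? ? ?; rewrite -ij // (agreeP _ _ _ ag).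
Qed.

Lemma mem_new i s T : new i s T -> T \notin s.
Proof. by apply: contra => Ts; apply/inferredP; exists T. Qed.

(** If more than [d] entries were new, sorting them under [rep i] and applying [chain_inference]
    would produce one whose lower bound follows from the order of earlier ones, all still present
    after its deletion. *)
Lemma new_dim d i s : (d.+1 ^ #|U| < 2 ^ d)%N ->
  (\sum_(q < size s) new i (delete q s) (nth set0 s q) <= d)%N.
Proof.
move=> lt_card; pose Q := [set q : 'I_(size s) | new i (delete q s) (nth set0 s q)].
have -> : (\sum_(q < size s) new i (delete q s) (nth set0 s q))%N = #|Q|.
  by rewrite -sum1_card [RHS]big_mkcond; apply: eq_bigr => q _; rewrite inE; case: new.
rewrite leqNgt; apply/negP => lt_dQ.
pose v := [seq nth set0 s (q : 'I_(size s)) | q <- enum Q].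
(* Of two equal entries, one survives the deletion of the other and makes it inferred. *)
have uniq_v : uniq v.
  rewrite map_inj_in_uniq ?enum_uniq // => q r.
  rewrite !mem_enum !inE => newq newr eq_qr; apply/val_inj/eqP; move: newq.
  apply: contraTT => ne_qr; apply: contraL (_ : nth set0 s q \in delete q s) => [|//].
    exact: mem_new.
  rewrite /delete mem_cat eq_qr; apply/orP.
  case: (ltngtP q r) ne_qr => // lt_qr _; [right | left].
    have -> : nth set0 s r = nth set0 (drop q.+1 s) (r - q.+1) by rewrite nth_drop subnKC.
    by apply: mem_nth; rewrite size_drop ltn_sub2r // (leq_ltn_trans lt_qr).
  by rewrite -(nth_take set0 lt_qr) mem_nth // size_takel // ltnW.
pose t := sort (before (rep i)) v.
have uniq_t : uniq t by rewrite sort_uniq.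
have size_t : (d < size t)%N by rewrite size_sort size_map -cardE.
have [k lt_kd kP] := chain_inference (nth set0 t) lt_card.
have lt_kt : (k.+1 < size t)%N by exact: leq_ltn_trans size_t.
have : nth set0 t k.+1 \in v by rewrite -(mem_sort (before (rep i))) mem_nth.
case/mapP=> q; rewrite mem_enum inE => newq def_q; move: newq; rewrite -def_q.
apply/negP/negPn/inferredP.
have sub_t (j : nat) : (j <= k)%N -> nth set0 t j \in delete q s.
  move=> le_jk; have lt_jt : (j < size t)%N by lia.
  have : nth set0 t j \in s.
    have : nth set0 t j \in v by rewrite -(mem_sort (before (rep i))) mem_nth.
    by case/mapP=> r _ ->; rewrite mem_nth.
  rewrite -(delete_mem set0 (ltn_ord q)) inE -def_q nth_uniq // => /orP[|//].
  by rewrite ltn_eqF // ltnS.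
exists (nth set0 t 0); first exact: sub_t.
move=> j /agreeP ag; apply: kP => l lt_lk; apply: before_weight.
rewrite -ag ?sub_t ?(ltnW lt_lk) //.
have /(sortedP set0) sorted_t := sort_sorted (before_total (rep i)) v.
by apply: sorted_t; rewrite -/t; lia.
Qed.
End Cells.
End Weights.

(** * Binary insertion sort *)

Section Sorting.
Variables (R : realType) (U : finType) (F : {set {set U}}).
Implicit Types (w : U -> R) (s : seq {set U}) (k : seq {set U} -> algorithm U).

Definition answer_before (S T : {set U}) (c : comparison) :=
  match c with Lt => true | Gt => false | Eq => (enum_rank S <= enum_rank T)%N end.

Lemma answer_beforeE w S T :
  answer_before S T (comparison_oracle w S T) = before w S T.
Proof. by rewrite /comparison_oracle /before; case: ltgtP. Qed.

(* Binary insertion of [S] into a sorted [l ++ s ++ r], its place being in [s];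
   [k] is what the algorithm does next with the resulting list. *)
Lemma insert_algorithm (S : {set U}) t l s r k : S \in F -> {subset s <= F} ->
    (forall s', queries_within F (k s')) -> (size s < 2 ^ t)%N ->
  exists2 a, queries_within F a & forall w,
    sorted (before w) (l ++ s ++ r) ->
    all (before w ^~ S) l -> all (before w S) r ->
    exists s', [/\ perm_eq s' (S :: l ++ s ++ r), sorted (before w) s',
      output (comparison_oracle w) a = output (comparison_oracle w) (k s') &
      (query_count (comparison_oracle w) a
        <= t + query_count (comparison_oracle w) (k s'))%N].
Proof.
move=> SF; elim: t l s r => [|t IH] l s r sF kF size_s.
  case: s size_s {sF} => // _; exists (k (l ++ S :: r)) => // w.
  rewrite cat0s => sorted_lr lS Sr; exists (l ++ S :: r); split=> //.
    by rewrite -cat1s perm_catCA.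
  move: sorted_lr; rewrite !(sorted_pairwise (@before_trans _ _ w)) !pairwise_cat /=.
  case/and3P=> lr -> ->; rewrite Sr !andbT /allrel.
  apply/allP=> x xl /=; rewrite (allP lS) //=.
  by have /allP/(_ x xl) := lr.
case: s sF size_s => [|x0 s0] sF size_s.
  have [|a aF aP] := IH l [::] r sF kF; first by rewrite expn_gt0.
  exists a => // w sw lS Sr; have [s' [? ? ? le_a]] := aP w sw lS Sr.
  by exists s'; split=> //; rewrite (leq_trans le_a) // addSn leqW.
set s := x0 :: s0; pose p := (size s)./2.
have lt_ps : (p < size s)%N by rewrite /p /s /=; lia.
pose s1 := take p s; pose y := nth x0 s p; pose s2 := drop p.+1 s.
have def_s : s = s1 ++ y :: s2 by rewrite /s1 /y /s2 -drop_nth // cat_take_drop.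
have s1F : {subset s1 <= F} by move=> z /mem_take/sF.
have s2F : {subset s2 <= F} by move=> z /mem_drop/sF.
have yF : y \in F by apply/sF/mem_nth.
(* The pivot belongs to neither half, so a list shorter than [2 ^ t.+1] splits into two shorter than
   [2 ^ t]. *)
have size_half : (size s1 < 2 ^ t)%N /\ (size s2 < 2 ^ t)%N.
  by move: size_s; rewrite -/s size_takel ?size_drop ?(ltnW lt_ps) // /p expnS; lia.
have [a1 a1F a1P] := IH l s1 (y :: s2 ++ r) s1F kF size_half.1.
have [a2 a2F a2P] := IH (l ++ s1 ++ [:: y]) s2 r s2F kF size_half.2.
exists (Query S y (fun c => if answer_before S y c then a1 else a2)).
  by split=> // c; case: ifP.
move=> w sorted_w lS Sr; rewrite /= answer_beforeE.
have eq1 : l ++ s ++ r = l ++ s1 ++ y :: s2 ++ r by rewrite def_s -catA.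
have eq2 : l ++ s ++ r = (l ++ s1 ++ [:: y]) ++ s2 ++ r by rewrite def_s -!catA.
have pairw := sorted_w; rewrite eq1 (sorted_pairwise (@before_trans _ _ w)) !pairwise_cat /= in pairw.
rewrite -/s in sorted_w *.
have [Sy|yS] := boolP (before w S y).
  have [||s' [perm_s' sorted_s' out_s' cnt_s']] := a1P w _ lS; first by rewrite -eq1.
    rewrite /= Sy all_cat Sr andbT; apply/allP=> z zs2.
    apply: before_trans Sy _; case/and5P: pairw => _ _ _ _ /andP[+ _].
    by rewrite all_cat => /andP[/allP/(_ z zs2) + _].
  by exists s'; rewrite eq1; split.
have {}yS : before w y S by have := before_total w S y; rewrite (negbTE yS).
have [||s' [perm_s' sorted_s' out_s' cnt_s']] := a2P w _ _ Sr; first by rewrite -eq2.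
  rewrite !all_cat lS /= yS !andbT; apply/allP=> z zs1.
  apply: before_trans yS; case/and3P: pairw => _ _ /andP[+ _].
  by rewrite /allrel => /allP/(_ z zs1) /= /andP[].
by exists s'; rewrite eq2; split.
Qed.

Lemma sort_algorithm t s k : {subset s <= F} ->
    (forall s', queries_within F (k s')) -> (size s < 2 ^ t)%N ->
  exists2 a, queries_within F a & forall w,
    exists s', [/\ perm_eq s' s, sorted (before w) s',
      output (comparison_oracle w) a = output (comparison_oracle w) (k s') &
      (query_count (comparison_oracle w) a
        <= size s * t + query_count (comparison_oracle w) (k s'))%N].
Proof.
elim: s k => [|S s IH] k sF kF size_s.
  by exists (k [::]) => // w; exists [::].
have SF : S \in F by apply: sF; rewrite mem_head.
have {}sF : {subset s <= F} by move=> x xs; apply: sF; rewrite inE xs orbT.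
(* The continuation must be a function on all lists, chosen before [w] is known; lists that are not
   permutations of [s] get a dummy output. *)
have ins (s' : seq {set U}) : exists a, queries_within F a /\
    (perm_eq s' s -> forall w, sorted (before w) s' ->
    exists s'', [/\ perm_eq s'' (S :: s'), sorted (before w) s'',
      output (comparison_oracle w) a = output (comparison_oracle w) (k s'') &
      (query_count (comparison_oracle w) a
        <= t + query_count (comparison_oracle w) (k s''))%N]).
  have [eq_s'|ne_s'] := boolP (perm_eq s' s); last by exists (Output set0).
  have [||a aF aP] := @insert_algorithm S t [::] s' [::] k SF _ kF.
  - by move=> x; rewrite (perm_mem eq_s'); exact: sF.
  - by rewrite (perm_size eq_s') (leq_trans _ size_s) //= ltnW.
  exists a; split=> // _ w sw; have := aP w; rewrite /= cats0; exact.
have [k' k'P] := choice ins.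
have [||a aF aP] := IH k' sF; first by move=> s'; have [] := k'P s'.
  exact: ltn_trans size_s.
exists a => // w; have [s' [perm_s' sorted_s' out_s' cnt_s']] := aP w.
have [_ /(_ perm_s' w sorted_s')[s'' [perm_s'' sorted_s'' out_s'' cnt_s'']]] := k'P s'.
exists s''; split=> //; first by rewrite (perm_trans perm_s'') // perm_cons.
  by rewrite out_s'.
by rewrite (leq_trans cnt_s') //= mulSn; lia.
Qed.
End Sorting.

(** * Elimination *)

(** Since ties are broken, positions in a sorted list decide the relation; two weights that sort a
    list alike therefore agree on it. *)
Lemma before_index (R : realType) (U : finType) (w : U -> R) (s : seq {set U}) :
  sorted (before w) s ->
  {in s &, forall S T, before w S T = (index S s <= index T s)%N}.
Proof.
move=> sorted_s S T Ss Ts.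
have before_refl : reflexive (before w) by move=> A; have := before_total w A A; rewrite orbb.
have mono A B : A \in s -> B \in s -> (index A s <= index B s)%N -> before w A B.
  move=> As Bs le_AB; rewrite -(nth_index set0 As) -(nth_index set0 Bs).
  by apply: (sorted_leq_nth (@before_trans _ _ w) before_refl) => //; rewrite inE index_mem.
apply/idP/idP => [ST|]; last exact: mono.
rewrite leqNgt; apply/negP => lt_TS.
have eqST : S = T by apply: (@before_anti _ _ w); rewrite ST mono // ltnW.
by rewrite eqST ltnn in lt_TS.
Qed.

Section Elimination.
Variables (R : realType) (U : finType) (F : {set {set U}}).
Variables (K : nat) (rep : 'I_K -> U -> R) (d t : nat).
Hypothesis lt_d : (d.+1 ^ #|U| < 2 ^ d)%N.
Hypothesis lt_t : (64 * d < 2 ^ t)%N.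
Let m := (64 * d)%N.

Definition poor (X : {set {set U}}) (i : 'I_K) (s : seq {set U}) :=
  uninformative (enum X) (new rep i) s.

(** Double counting of pairs of a word and an order in [C]: each order is poor for at most a
    [2 * 2 ^ (- m)] fraction of the words, so some word is poor for at most that fraction of [C]. *)
Lemma exists_good_sample (X : {set {set U}}) (C : {set 'I_K}) : X != set0 ->
  exists s, [/\ size s = m, {subset s <= X} &
    (#|[set i in C | poor X i s]| * 2 ^ m <= 2 * #|C|)%N].
Proof.
move=> X0; have def_m : m = (32 * d).*2 by rewrite /m; lia.
have N_gt0 : (0 < size (words (enum X) m))%N.
  by rewrite size_words -cardE expn_gt0 card_gt0 X0.
have : has (fun s => #|[set i in C | poor X i s]| * 2 ^ m <= 2 * #|C|)%N (words (enum X) m).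
  apply: contraT => /hasPn many_poor.
  have : (\sum_(s <- words (enum X) m) (2 * #|C|).+1
      <= \sum_(s <- words (enum X) m) #|[set i in C | poor X i s]| * 2 ^ m)%N.
    rewrite big_seq [leqRHS]big_seq; apply: leq_sum => s /many_poor.
    by rewrite -ltnNge.
  rewrite big_const_seq count_predT iter_addn_0 -big_distrl /=.
  under [X in (_ <= X * _)%N -> _]eq_bigr => s _.
    rewrite -sum1_card big_mkcond /=.
    under eq_bigr => i _ do rewrite inE.
    over.
  rewrite exchange_big /= big_distrl /= leqNgt => /negP[].
  apply: (@leq_ltn_trans (\sum_(i in C) 2 * size (words (enum X) m))%N); last first.
    rewrite sum_nat_const; move: (size _) N_gt0 => N N_gt0.
    by rewrite mulnCA mulnA mulSn -[ltnLHS]add0n ltn_add2r.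
  rewrite [leqRHS]big_mkcond; apply: leq_sum => i _.
  case: (i \in C) => /=; last by rewrite big1.
  rewrite -big_mkcond sum1_count size_words def_m.
  apply: (@few_uninformative _ set0 _ _ d); last by lia.
  - exact: new_anti.
  - by move=> s; exact: new_dim.
case/hasP=> s /mem_words[size_s sX] few; exists s; split=> // x /sX.
by rewrite mem_enum.
Qed.

Lemma poor_agree X i j s : agree rep i j s -> poor X i s = poor X j s.
Proof.
by move=> ag; congr (16 * _ <= _)%N; apply: eq_count => S /=; rewrite (new_agree ag).
Qed.

(** Fewer than [15/16] of [X] stay new, and putting [S] back costs at most [1/32] of [X]. *)
Lemma card_not_poor (X : {set {set U}}) i s S : ~~ poor X i s -> (32 <= #|X|)%N ->
  (32 * #|S |: [set T in X | new rep i s T]| <= 31 * #|X|)%N.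
Proof.
rewrite /poor /uninformative -ltnNge -cardE => good X_ge32.
have := cardsU1 S [set T in X | new rep i s T].
have -> : #|[set T in X | new rep i s T]| = count (new rep i s) (enum X).
  rewrite -sum1_card -sum1_count big_enum_cond /=.
  by apply: eq_bigl => T; rewrite inE.
have := count_predC (new rep i s) (enum X); rewrite -cardE.
move: (#|S |: _|) (count (new _ _ _) _) (count (predC _) _) (#|X|) X_ge32 good => y a b x.
by case: (S \notin _) => /=; lia.
Qed.

(** A discarded set weighs at least some member of the sample, hence at least the sample minimum
    [S]. As a sample member, [S] is not new itself and has to be put back. *)
Lemma argmin_eliminate (X : {set {set U}}) (w : U -> R) i s S T :
    {subset s <= X} -> X \subset F -> same_order F w (rep i) -> S \in s ->
    {in s, forall A, weight w S <= weight w A} ->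
  T \in argmin (S |: [set A in X | new rep i s A]) w -> T \in argmin X w.
Proof.
move=> sX /subsetP XF wi Ss minS; rewrite !inE => /andP[TX /forallP minT].
have {TX}TX : T \in X.
  by case/orP: TX => [/eqP ->|/andP[]//]; exact: sX.
rewrite TX; apply/forallP=> A; apply/implyP=> AX.
have [newA|] := boolP (new rep i s A).
  by have := minT A; rewrite !inE AX newA orbT.
rewrite negbK => /inferredP[B Bs BA].
have le_BA : weight w B <= weight w A.
  by rewrite (wi B A) ?(XF A AX) ?(XF B (sX B Bs)) //; apply: BA; apply/agreeP.
have := minT S; rewrite !inE eqxx /= => /le_trans; apply.
exact: le_trans (minS _ Bs) le_BA.
Qed.

(* [C] is the set of orders still possible. A round replaces [p] by [p - 1] when
   the sample eliminates enough sets, and [q] by [q - 1] when it does not. *)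
Lemma min_algorithm (X : {set {set U}}) (C : {set 'I_K}) p q :
    X \subset F -> X != set0 -> (0 < d)%N ->
    (#|X| * 31 ^ p <= 32 ^ p)%N -> (#|C| < 2 ^ (m.-1 * q))%N ->
  exists2 a, queries_within F a & forall w i, i \in C -> same_order F w (rep i) ->
    output (comparison_oracle w) a \in argmin X w /\
    (query_count (comparison_oracle w) a <= (p + q).+1 * (m * t))%N.
Proof.
move=> XF X0 d_gt0; move: {2}(p + q).+1 (ltnSn (p + q)) => v.
elim: v X C p q XF X0 => [|v IH] X C p q XF X0 // lt_v leX leC.
have sub_XF : {subset X <= F} by apply/subsetP.
have [le_Xm|lt_mX] := leqP #|X| m.
  have [||a aF aP] := @sort_algorithm R U F t (enum X) (fun s => Output (head set0 s)) _ (fun=> I).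
  - by move=> S; rewrite mem_enum; exact: sub_XF.
  - by rewrite -cardE (leq_ltn_trans le_Xm).
  exists a => // w i _ _; have [s [perm_s sorted_s -> cnt_s]] := aP w.
  have memX : s =i X by move=> S; rewrite (perm_mem perm_s) mem_enum.
  split; last first.
    rewrite (leq_trans cnt_s) //= addn0 -cardE mulSn (leq_trans _ (leq_addr _ _)) //.
    by rewrite leq_mul2r le_Xm orbT.
  case: s sorted_s memX {perm_s cnt_s} => [|S s] sorted_s memX.
    by case/set0Pn: X0 => S; rewrite -memX.
  rewrite inE -memX mem_head; apply/forallP=> T; apply/implyP; rewrite -memX => Ts.
  by apply: before_weight; rewrite (before_index sorted_s) ?mem_head //= eqxx.
have p_gt0 : (0 < p)%N by case: p leX {lt_v} => //; rewrite /m in lt_mX; lia.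
(* With [q = 0] the set [C] is empty, so no weight has to be served. *)
have [q0|q_gt0] := posnP q.
  exists (Output set0) => // w i; move: leC.
  by rewrite q0 muln0 ltnS leqn0 cards_eq0 => /eqP ->; rewrite inE.
have [s [size_s sX few_poor]] := exists_good_sample C X0.
have sF : {subset s <= F} by move=> S /sX/sub_XF.
have next (s' : seq {set U}) : exists a, queries_within F a /\
    (perm_eq s' s -> forall w i, i \in C -> same_order F w (rep i) ->
      sorted (before w) s' -> output (comparison_oracle w) a \in argmin X w /\
      (query_count (comparison_oracle w) a <= (p + q) * (m * t))%N).
  have [perm_s|] := boolP (perm_eq s' s); last by exists (Output set0).
  have s'F : {subset s' <= F} by move=> S; rewrite (perm_mem perm_s); exact: sF.
  have sorted_rep w i : same_order F w (rep i) ->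
      sorted (before w) s' = sorted (before (rep i)) s'.
    move/same_order_before=> wi; apply: (@eq_in_sorted _ (mem F)) => //.
    exact/allP.
  (* [i0] is any possible order consistent with the sorted sample; if there is none, no admissible
     weight reaches this branch. *)
  case: (pickP [pred i in C | sorted (before (rep i)) s'])
      => [i0 /andP[i0C sorted0]|none]; last first.
    exists (Output set0); split=> // _ w i iC wi; rewrite (sorted_rep w i wi) => sorted_i.
    by have /negP[] := none i; rewrite /= iC.
  have agree0 w i : same_order F w (rep i) -> sorted (before w) s' -> agree rep i0 i s.
    move=> wi; rewrite (sorted_rep w i wi) => sorted_i; apply/agreeP => S T Ss Ts.
    by rewrite (before_index sorted0) ?(before_index sorted_i) ?(perm_mem perm_s).
  (* The true order agrees with [i0] on [s], so it is poor exactly when [i0] is: either it lies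
     among the few poor orders, or [X] shrinks. *)
  have [poor0|rich0] := boolP (poor X i0 s).
    have [|||a aF aP] := IH X [set i in C | poor X i s] p q.-1 XF X0 => //.
    - by lia.
    - have m_gt0 : (0 < m)%N by rewrite /m; lia.
      have def_2m : (2 ^ m = 2 * 2 ^ m.-1)%N by rewrite -expnS prednK.
      have def_2q : (2 ^ (m.-1 * q) = 2 ^ m.-1 * 2 ^ (m.-1 * q.-1))%N.
        by rewrite -expnD -mulnS prednK.
      move: few_poor leC; rewrite def_2m def_2q.
      set c := #|_|; set P := (2 ^ m.-1)%N; set Q := (2 ^ (_ * _))%N => few leC.
      have P_gt0 : (0 < P)%N by rewrite expn_gt0.
      by rewrite -(ltn_pmul2l P_gt0); lia.
    exists a; split=> // _ w i iC wi sorted_s'.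
    have [|out cnt] := aP w i _ wi.
      by rewrite inE iC -(poor_agree _ (agree0 w i wi sorted_s')).
    by split=> //; move: cnt; rewrite -addnS prednK.
  pose S := head set0 s'.
  have Ss : S \in s.
    rewrite -(perm_mem perm_s) /S; move: (perm_size perm_s); rewrite size_s /m.
    by case: (s') => [|? ?]; rewrite ?mem_head //=; lia.
  have [|||||a aF aP] := IH (S |: [set T in X | new rep i0 s T]) C p.-1 q => //.
  - by apply/subsetP=> T; rewrite !inE => /orP[/eqP ->|/andP[/sub_XF]//]; exact: sF.
  - by apply/set0Pn; exists S; rewrite !inE eqxx.
  - by lia.
  - have X_ge32 : (32 <= #|X|)%N by rewrite /m in lt_mX; lia.
    have := card_not_poor S rich0 X_ge32; move: leX.
    rewrite -{1 2}(prednK p_gt0) !expnS; move: (31 ^ _)%N (32 ^ _)%N => x y leX le_card.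
    rewrite -(@leq_pmul2l 32) //; apply: leq_trans leX.
    by rewrite mulnA [leqRHS]mulnA leq_mul2r [(_ * 31)%N]mulnC le_card orbT.
  exists a; split=> // perm' w i iC wi sorted_s'.
  have [out cnt] := aP w i iC wi; split; last by move: cnt; rewrite -addSn prednK.
  have ag := agree0 w i wi sorted_s'.
  apply: (argmin_eliminate (i := i) sX XF wi Ss).
    move=> A As; apply: before_weight.
    rewrite (before_index sorted_s') ?(perm_mem perm_s) // /S.
    move: As; rewrite -(perm_mem perm_s); case: (s') => //= B s1 _; by rewrite eqxx.
  move: out; congr (_ \in argmin (_ |: _) w); apply/setP=> T.
  by rewrite !inE (new_agree ag).
have [k kP] := choice next.
have [||a aF aP] := @sort_algorithm R U F t s k sF.
- by move=> s'; have [] := kP s'.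
- by rewrite size_s.
exists a => // w i iC wi; have [s' [perm_s' sorted_s' -> cnt]] := aP w.
have [_ /(_ perm_s' w i iC wi sorted_s')[out cnt']] := kP s'; split=> //.
by rewrite (leq_trans cnt) // size_s mulSn leq_add2l.
Qed.
End Elimination.

(** * Choice of the parameters and logarithmic estimates *)

(** Bernoulli's inequality gives [(1 + 1/c)^c >= 2]. For [c = 31] it shows that [31 * l] shrinking
    rounds exhaust a family of at most [2 ^ l] sets. *)
Lemma expn_succ_ge2 c k : (0 < c)%N -> (2 ^ k * c ^ (c * k) <= c.+1 ^ (c * k))%N.
Proof.
move=> c_gt0.
have bernoulli b : (c ^ b * (c + b) <= c * c.+1 ^ b)%N.
  elim: b => [|b IH]; first by rewrite !expn0; lia.
  rewrite !expnS; move: IH; move: (c ^ b)%N (c.+1 ^ b)%N => x y; nia.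
rewrite !expnM -expnMn leq_exp2r_weak //.
by have := bernoulli c; rewrite addnn -muln2 mulnCA leq_pmul2l // mulnC.
Qed.

Lemma dimension_bound n (t := up_log 2 n) : (1 < n)%N ->
  ((8 * n * t).+1 ^ n < 2 ^ (8 * n * t))%N.
Proof.
move=> n_gt1; have t_gt0 : (0 < t)%N by rewrite up_log_gt0.
have le_n : (n <= 2 ^ t)%N by exact: up_logP.
have lt_t : (t < 2 ^ t)%N by exact: ltn_expl.
have small : ((8 * n * t).+1 < 2 ^ (t * 8))%N.
  have : (2 <= 2 ^ t)%N by rewrite -[X in (X <= _)%N]expn1 leq_exp2l.
  rewrite expnM; move: le_n lt_t; move: (2 ^ t)%N => y *.
  have : (2 ^ 6 <= y ^ 6)%N by rewrite leq_exp2r.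
  have -> : (y ^ 8 = y * y * y ^ 6)%N by rewrite mulnn -expnD.
  rewrite -[(2 ^ 6)%N]/64%N; move: (y ^ 6)%N => z; nia.
rewrite (_ : 2 ^ (8 * n * t) = (2 ^ (t * 8)) ^ n)%N; last first.
  by rewrite -expnM mulnAC (mulnC 8).
by rewrite ltn_exp2r // ltnW.
Qed.

Lemma ln_up_log2 (R : realType) n : (1 < n)%N ->
  (up_log 2 n)%:R * ln 2 <= 2 * ln n%:R :> R.
Proof.
move=> n_gt1; have n_gt0 : 0 < n%:R :> R by rewrite ltr0n ltnW.
rewrite mulr_natl [leRHS]mulr_natl -!lnXn // ?ltr0n //.
rewrite ler_ln ?posrE ?exprn_gt0 // -!natrX ler_nat.
have /andP[lt_n _] := up_log_bounds (isT : (1 < 2)%N) n_gt1.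
rewrite -[up_log 2 n]prednK ?up_log_gt0 // expnS -mulnn.
by rewrite leq_mul // ltnW.
Qed.

Lemma argmin_algorithm (U : finType) (F : {set {set U}}) (n := #|U|)
    (t := up_log 2 n) (l := up_log 2 #|F|) (R : realType) :
    (1 < n)%N -> (1 < #|F|)%N ->
  exists2 a, queries_within F a & forall w : U -> R,
    output (comparison_oracle w) a \in argmin F w /\
    (query_count (comparison_oracle w) a <= 33 * (64 * (8 * 12)) * (n * t ^ 2 * l))%N.
Proof.
move=> n_gt1 F_gt1; have [K [rep [le_K repP]]] := finite_weight_orders R F.
have t_gt0 : (0 < t)%N by rewrite up_log_gt0.
have l_gt0 : (0 < l)%N by rewrite up_log_gt0.
pose d := (8 * n * t)%N.
have n_gt0 : (0 < n)%N by exact: ltnW.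
have d_gt0 : (0 < d)%N by rewrite !muln_gt0 n_gt0 t_gt0.
have lt_d : (64 * d < 2 ^ (12 * t))%N.
  have le_n : (n <= 2 ^ t)%N by exact: up_logP.
  have lt_t : (t < 2 ^ t)%N by exact: ltn_expl.
  have : (2 <= 2 ^ t)%N by rewrite -[X in (X <= _)%N]expn1 leq_exp2l.
  rewrite [(12 * t)%N]mulnC expnM /d; move: le_n lt_t; move: (2 ^ t)%N => y *.
  have : (2 ^ 10 <= y ^ 10)%N by rewrite leq_exp2r.
  have -> : (y ^ 12 = y * y * y ^ 10)%N by rewrite mulnn -expnD.
  rewrite -[(2 ^ 10)%N]/1024%N; move: (y ^ 10)%N => z; nia.
have [|||a aF aP] := @min_algorithm R U F K rep d (12 * t) (dimension_bound n_gt1) lt_d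
    F setT (31 * l) l (subxx _) _ d_gt0.
- by rewrite -card_gt0 ltnW.
- apply: leq_trans (expn_succ_ge2 l (isT : (0 < 31)%N)); rewrite leq_mul2r up_logP ?orbT //.
- rewrite cardsT card_ord (leq_ltn_trans le_K) //.
  (* [#|F| ^ 2 + 1 < 2 ^ (3 * l)], and [3 * n] is at most [64 * d - 1], so [q = l] suffices. *)
  apply: (@leq_trans ((2 ^ (3 * l)) ^ n)); last first.
    rewrite -expnM leq_exp2l // mulnAC leq_mul2r; apply/orP; right; rewrite /d; nia.
  rewrite ltn_exp2r; last exact: ltnW.
  have : (#|F| <= 2 ^ l)%N by exact: up_logP.
  have : (2 <= 2 ^ l)%N by rewrite -[X in (X <= _)%N]expn1 leq_exp2l.
  rewrite [(3 * l)%N]mulnC expnM !expnS expn0; move: (2 ^ l)%N #|F| => y x; nia.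
exists a => // w; have [i wi] := repP w; have [out cnt] := aP w i (in_setT i) wi.
split=> //; apply: leq_trans cnt _.
apply: (@leq_trans (33 * l * (64 * d * (12 * t)))); first by rewrite leq_mul2r; lia.
by rewrite /d -mulnn; lia.
Qed.

Theorem mainTheorem1 (R : realType) :
  (exists C : R, forall (n : nat) (U : finType) (F : {set {set U}}),
    (2 <= n)%N -> #|U| = n -> (0 < #|F|)%N ->
    exists a : algorithm U,
      queries_within F a /\
      forall w : U -> R,
        output (comparison_oracle w) a \in argmin F w /\
        (query_count (comparison_oracle w) a)%:R <= C * query_bound R n #|F|)
  /\
  (exists (C : R) (k : nat), forall (n : nat) (U : finType) (F : {set {set U}}),
    (2 <= n)%N -> #|U| = n -> (0 < #|F|)%N ->
    query_bound R n #|F| <= C * (n%:R ^+ 2 * ln n%:R ^+ k)).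
Proof.
have ln2_gt0 : 0 < ln 2 :> R by rewrite ln_gt0 // ltr1n.
split; last first.
  exists (ln 2), 2%N => n U F n_gt1 cardU F_gt0.
  have lnF : ln #|F|%:R <= n%:R * ln 2 :> R.
    rewrite mulr_natl -lnXn // ler_ln ?posrE ?exprn_gt0 ?ltr0n // -natrX ler_nat.
    rewrite -cardU -cardsT -card_powerset subset_leq_card //.
    by apply/subsetP=> S _; rewrite powersetE subsetT.
  rewrite /query_bound; set c := ln n%:R ^+ 2.
  have c_ge0 : 0 <= c by rewrite sqr_ge0.
  rewrite (_ : _ * (_ * c) = (n%:R * c) * (n%:R * ln 2)); last by ring.
  by rewrite ler_wpM2l // mulr_ge0.
(* Each of the three rounded-up binary logarithms is at most [2 / ln 2] times the natural one,
   whence [8 / ln 2 ^+ 3]. *)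
exists ((33 * (64 * (8 * 12)))%:R * 8 / ln 2 ^+ 3) => n U F n_gt1 cardU F_gt0.
(* For a single feasible set the bound is zero, so the answer must come without a query. *)
have [F_gt1|F_le1] := ltnP 1 #|F|; last first.
  have /eqP/cards1P[S defF] : #|F| = 1%N by apply/eqP; rewrite eqn_leq F_le1.
  exists (Output S); split=> // w; split.
    rewrite /= inE defF set11; apply/forallP=> T; apply/implyP.
    by rewrite inE => /eqP ->.
  by rewrite /query_bound defF cards1 ln1 !mulr0.
rewrite -cardU in n_gt1 *.
have [a aF aP] := argmin_algorithm R n_gt1 F_gt1.
exists a; split=> // w; have [out cnt] := aP w; split=> //.
move: cnt; rewrite -(ler_nat R) => /le_trans; apply.
have := ln_up_log2 R n_gt1; have := ln_up_log2 R F_gt1.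
rewrite /query_bound; set x := ln #|U|%:R; set y := ln #|F|%:R => le_y le_x.
rewrite natrM [X in _ * X]natrM [X in _ * (X * _)]natrM natrX.
rewrite -!mulrA ler_pM2l; last by rewrite ltr0n.
set t := (up_log 2 #|U|)%:R; set l := (up_log 2 #|F|)%:R.
have t_ge0 : 0 <= t * ln 2 by rewrite mulr_ge0 // ltW.
have l_ge0 : 0 <= l * ln 2 by rewrite mulr_ge0 // ltW.
have x_ge0 : 0 <= x by rewrite ln_ge0 // ler1n ltnW.
rewrite [leRHS](_ : _ = #|U|%:R * ((2 * x) ^+ 2 * (2 * y) / ln 2 ^+ 3)); last by ring.
rewrite ler_wpM2l // ler_pdivlMr ?exprn_gt0 //.
rewrite [leLHS](_ : _ = (t * ln 2) ^+ 2 * (l * ln 2)); last by ring.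
by rewrite ler_pM ?sqr_ge0 // ler_pXn2r // nnegrE // mulr_ge0.
Qed.
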